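(* Let $f_1,\dots,f_c\in\mathbb{C}[x_0,\dots,x_n]$ be homogeneous polynomials of positive degrees $d_1,\dots,d_c$ and let $X=V(f_1,\dots,f_c)\subseteq\mathbb{P}^n$. For any $k\ge 1$, the Fano scheme $F_k(X)$ is defined by equations whose collective strength is at least the collective strength of $f_1,\dots,f_c$; that is, the ideal $J\subseteq\mathbb{C}[u_{0,0},\dots,u_{k,n}]$ defining $F_k(X)$ has a finite generating set of homogeneous polynomials whose collective strength is at least the collective strength of $f_1,\dots,f_c$.
   Context: Everything is over $\mathbb{C}$. $F_k(X)\subseteq\mathbb{G}(k,n)$ is the Fano scheme of $k$-planes contained in $X\subseteq\mathbb{P}^n$. The Grassmannian $\mathbb{G}(k,n)$ is the quotient by $GL_{k+1}$ of the open set of rank $k+1$ matrices in the space of $(k+1)\times(n+1)$ matrices, whose coordinate ring is $\mathbb{C}[u_{0,0},\dots,u_{k,n}]$ (a matrix corresponds to the plane spanned by its rows). The ideal $J$ defining $F_k(X)$ in these coordinates is as follows: introduce variables $s_0,\dots,s_k$, put $X_i=s_0u_{0,i}+\cdots+s_ku_{k,i}$ for $0\le i\le n$, and write $f_\ell(X_0,\dots,X_n)=\sum_{|\alpha|=d_\ell}s^\alpha g_{\ell,\alpha}(\mathbf{u})$; then $J$ is the ideal generated by all the polynomials $g_{\ell,\alpha}(\mathbf{u})$. Strength: a nonzero homogeneous polynomial $f$ of degree $d$ has strength $s$ if $f=\sum_{i=0}^{s}g_ih_i$ with $g_i,h_i$ homogeneous, $1\le\deg(g_i),\deg(h_i)\le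 d-1$, and $s$ is minimal with this property (strength $\infty$ if no such expression exists); the zero polynomial has strength $-\infty$. The collective strength of a finite collection of homogeneous polynomials is the minimum of the strengths of all nontrivial homogeneous $\mathbb{C}$-linear combinations of them (coefficients not all zero, nonzero only on polynomials of a single degree). *)

(* Defs.v *)
From HB Require Import structures.
(* mpoly has to be imported before classical_sets: in the other order their
   notations conflict. *)
From mathcomp Require Import all_boot all_order all_algebra.
From mathcomp Require Import mpoly complex.
From mathcomp Require Import boolp classical_sets reals constructive_ereal ereal.

Set Implicit Arguments.
Unset Strict Implicit.
Unset Printing Implicit Defensive.

Import Order.TTheory GRing.Theory Num.Theory.

Local Open Scope ring_scope.
Local Open Scope complex_scope.
Local Open Scope classical_set_scope.

Section Ideals.
Variable A : comNzRingType.

Definition ideal_generated (S : set A) : set A :=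
  [set p | exists (m : nat) (a g : 'I_m -> A),
     (forall i, S (g i)) /\ p = \sum_(i < m) a i * g i].

End Ideals.

Section Strength.
Variables (R : realType) (N : nat).
Implicit Types p : {mpoly R[i][N]}.

Definition homogeneous p : Prop := exists e : nat, p \is e.-homog.

(* [(msize p).-1] is the total degree of a nonzero [p]. *)
Definition has_decomposition p (s : nat) : Prop :=
  exists (g h : 'I_s.+1 -> {mpoly R[i][N]}) (a b : 'I_s.+1 -> nat),
    [/\ forall i, g i \is (a i).-homog /\ (1 <= a i <= (msize p).-1 - 1)%N,
        forall i, h i \is (b i).-homog /\ (1 <= b i <= (msize p).-1 - 1)%N
      & p = \sum_(i < s.+1) g i * h i].

(* The infima below are taken over sets of values in {-oo, 0, 1, 2, ..., +oo},
   so they are minima, except that the empty set has infimum +oo. *)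
Definition strength p : \bar R :=
  if p == 0 then -oo%E
  else ereal_inf [set (s%:R : R)%:E | s in [set s | has_decomposition p s]].

(* The combined polynomials must all be homogeneous of one degree e; the zero
   polynomial is homogeneous of every degree. *)
Definition nontrivial_homog_comb (m : nat) (f : 'I_m -> {mpoly R[i][N]}) :
    set {mpoly R[i][N]} :=
  [set p | exists (e : nat) (a : 'I_m -> R[i]),
     [/\ exists j, a j != 0,
         forall j, a j != 0 -> f j \is e.-homog
       & p = \sum_(j < m) a j *: f j]].

Definition collective_strength (m : nat) (f : 'I_m -> {mpoly R[i][N]}) :
    \bar R :=
  ereal_inf [set strength p | p in nontrivial_homog_comb f].

End Strength.

Section Fano.
Variables (R : realType) (n k : nat).

Local Notation U := {mpoly R[i][(k.+1 * n.+1)%N]}.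

Definition u_var (j : 'I_k.+1) (i : 'I_n.+1) : U := 'X_(mxvec_index j i).

(* U[s_0, ..., s_k] is represented as {mpoly U[k.+1]}. *)
Definition plane_coord (i : 'I_n.+1) : {mpoly U[k.+1]} :=
  \sum_(j < k.+1) (u_var j i)%:MP * 'X_j.

Definition restrict_to_plane (f : {mpoly R[i][n.+1]}) : {mpoly U[k.+1]} :=
  map_mpoly (@mpolyC (k.+1 * n.+1)%N R[i]) f
    \mPo [tuple plane_coord i | i < n.+1].

Definition fano_coef (f : {mpoly R[i][n.+1]}) (alpha : 'X_{1..k.+1}) : U :=
  (restrict_to_plane f)@_alpha.

Definition fano_ideal (c : nat) (d : 'I_c -> nat)
    (f : 'I_c -> {mpoly R[i][n.+1]}) : set U :=
  ideal_generated [set q | exists (l : 'I_c) (alpha : 'X_{1..k.+1}),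
     mdeg alpha = d l /\ q = fano_coef (f l) alpha].

End Fano.

Arguments fano_ideal {R n} k {c} d f.

(* Main.v *)
Require Import Defs.
From mathcomp Require Import all_boot all_order all_algebra.
From mathcomp Require Import mpoly complex.
From mathcomp Require Import ring.
From mathcomp Require Import boolp classical_sets reals constructive_ereal ereal.
Import Order.TTheory GRing.Theory Num.Theory.

(** Parametrize rank-one matrices by u_(j,i) = t_j x_i, where t is a vector of
    scalars.  The point of the plane with parameters s then has coordinates
    X_i = (s_0 t_0 + ... + s_k t_k) x_i, so a form f of degree d restricts to
    (s_0 t_0 + ... + s_k t_k)^d f(x).  Comparing coefficients of s^alpha, the
    equation g_alpha of the Fano scheme becomes
    (d! / alpha!) t^alpha f(x) ([fano_coef_rank_one]).

    Take the coefficients g_(l,alpha) themselves as generators, and consider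
    a combination p of them, with coefficients a_(l,alpha) that are not all
    zero.  The substitution turns p into the combination of the f_l in which
    f_l has the coefficient P_l(t), where P_l is the polynomial
    sum_alpha a_(l,alpha) (d_l! / alpha!) t^alpha.  In characteristic zero the
    multinomial coefficients do not vanish, so some P_l is nonzero, and over an
    infinite field t can be chosen with P_l(t) nonzero
    ([mpoly_nonvanishing]).  For that t the image of p is a nontrivial
    combination of the f_l.

    The substitution is linear in x, so it carries a decomposition of p into
    products of forms to one of the same length and degrees: strength does not
    increase ([strength_comp_mpoly]).  Hence the strength of p is at least that
    of a nontrivial combination of the f_l. *)

Set Implicit Arguments.
Unset Strict Implicit.
Unset Printing Implicit Defensive.

Local Open Scope ring_scope.
Local Open Scope complex_scope.
Local Open Scope classical_set_scope.

(** * Nonvanishing of polynomials over an infinite domain *)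

Lemma digits_inj (n B : nat) (a b : nat -> nat) :
  (forall i, (a i < B)%N) -> (forall i, (b i < B)%N) ->
  (\sum_(i < n) a i * B ^ i)%N = (\sum_(i < n) b i * B ^ i)%N ->
  forall i, (i < n)%N -> a i = b i.
Proof.
elim: n a b => // n IHn a b aB bB.
have B_gt0 : (0 < B)%N by apply: leq_trans (aB 0%N).
have horner (c : nat -> nat) : (\sum_(i < n.+1) c i * B ^ i)%N =
    ((\sum_(i < n) c i.+1 * B ^ i) * B + c 0)%N.
  rewrite big_ord_recl expn0 muln1 addnC big_distrl /=; congr (_ + _)%N.
  by apply: eq_bigr => i _; rewrite -mulnA -expnSr.
rewrite !horner => eq_ab.
have eq0 : a 0%N = b 0%N.
  by have /(congr1 (modn^~ B)) := eq_ab; rewrite !modnMDl !modn_small.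
case=> [|i] // lt_in; apply: (IHn (a \o S) (b \o S)) => //=.
by have /(congr1 (divn^~ B)) := eq_ab; rewrite !divnMDl // !divn_small // !addn0.
Qed.

(** The domain contains the distinct values 0, 1, ..., [size p - 1], too many to be
    all roots. *)
Lemma poly_nonroot (F : numDomainType) (p : {poly F}) :
  p != 0 -> exists x, p.[x] != 0.
Proof.
move=> p_neq0; pose xs := [seq (i%:R : F) | i <- iota 0 (size p)].
have [all_roots|] := boolP (all (root p) xs); last first.
  by case/allPn => x _ px_neq0; exists x.
have uniq_xs : uniq xs.
  by rewrite map_inj_uniq ?iota_uniq // => i j /eqP; rewrite eqr_nat => /eqP.
by have := max_poly_roots p_neq0 all_roots uniq_xs; rewrite size_map size_iota ltnn.
Qed.

(** Kronecker's substitution v_i = z ^ (B ^ i), with B larger than every exponent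
    of p, turns p into a univariate polynomial.  Distinct monomials m of p give
    distinct powers of z, because m lists the base-B digits of its exponent; hence
    no cancellation occurs. *)
Lemma mpoly_nonvanishing (F : numDomainType) (n : nat) (p : {mpoly F[n]}) :
  p != 0 -> exists v : 'I_n -> F, p.@[v] != 0.
Proof.
move=> p_neq0; pose B := msize p.
pose w (m : 'X_{1..n}) := (\sum_(i < n) m i * B ^ i)%N.
have ltB (m : 'X_{1..n}) i : m \in msupp p -> (m i < B)%N.
  move=> /msize_mdeg_lt; apply: leq_ltn_trans.
  by rewrite mdegE (bigD1 i) //= leq_addr.
have w_inj : {in msupp p &, injective w}.
  move=> m1 m2 m1p m2p; rewrite /w => eq_w; apply/mnmP => i0.
  (* Exponents extended by 0 outside 'I_n, as [digits_inj] expects. *)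
  pose dig (m : 'X_{1..n}) (j : nat) := if insub j is Some i then m i else 0%N.
  have digE (m : 'X_{1..n}) (i : 'I_n) : dig m i = m i by rewrite /dig valK.
  have dig_lt (m : 'X_{1..n}) j : m \in msupp p -> (dig m j < B)%N.
    move=> mp; rewrite /dig; case: insubP => [i _ _|_]; first exact: ltB.
    exact: leq_trans (ltB m i0 mp).
  rewrite -!digE; apply: (@digits_inj n B) => // [j|j|].
  - exact: dig_lt.
  - exact: dig_lt.
  - rewrite (eq_bigr (fun i : 'I_n => m1 i * B ^ i)%N); last by move=> i _; rewrite digE.
    by rewrite eq_w; apply: eq_bigr => i _; rewrite digE.
pose P : {poly F} := \sum_(m <- msupp p) p@_m *: 'X^(w m).
have P_neq0 : P != 0.
  have m0p := mlead_supp p_neq0.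
  apply/eqP => /(congr1 (coefp (w (mlead p)))) /eqP; apply/negP.
  rewrite /coefp coef0 coef_sum (bigD1_seq (mlead p)) ?msupp_uniq //=.
  rewrite coefZ coefXn eqxx mulr1 big_seq_cond big1 ?addr0 ?mleadc_eq0 //.
  move=> m /andP[mp m_neq]; rewrite coefZ coefXn.
  case: eqP => [eq_w|]; last by rewrite mulr0.
  by move/eqP: m_neq; case; apply: w_inj.
have [z Pz_neq0] := poly_nonroot P_neq0.
exists (fun i => z ^+ (B ^ i)).
rewrite mevalE; move: Pz_neq0; rewrite horner_sum.
under eq_bigr => m _.
  rewrite hornerZ hornerXn /w -prodrXr.
  under eq_bigr => i _ do rewrite mulnC exprM.
  over.
by [].
Qed.

(** * The multinomial theorem *)

Lemma mcoeffMXU (R : nzRingType) (n : nat) (p : {mpoly R[n]}) (j : 'I_n) (m : 'X_{1..n}) :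
  (p * 'X_j)@_m = if (0 < m j)%N then p@_(m - U_(j))%MM else 0.
Proof.
case: ifPn => [mj_gt0|].
  have Um : (U_(j) <= m)%MM by rewrite lep1mP -lt0n.
  by rewrite -{1}(submK Um) addmC mcoeffMX.
rewrite -leqNgt leqn0 => /eqP mj0; apply/eqP.
rewrite mcoeff_eq0 (perm_mem (msuppMX _ _)); apply/mapP => -[m' _ eq_m].
by move: mj0; rewrite eq_m mnmDE mnm1E eqxx.
Qed.

Definition multinomial (F : fieldType) n (m : 'X_{1..n}) : F :=
  (mdeg m)`!%:R / (\prod_(i < n) (m i)`!)%:R.

Lemma multinomial_neq0 (F : numFieldType) n (m : 'X_{1..n}) : multinomial F m != 0.
Proof.
by rewrite mulf_neq0 ?invr_eq0 // pnatr_eq0 -lt0n ?prodn_gt0 // => *; rewrite fact_gt0.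
Qed.

(** Induction on d: the coefficient of m in L^d * L is the sum over j of
    t_j times the coefficient of m - U_j in L^d, which is
    m_j * d! / m! times the monomial t^m; the m_j add up to d + 1. *)
Lemma mcoeff_linear_expn (F : numFieldType) (n d : nat) (t : 'I_n -> F) (m : 'X_{1..n}) :
  mdeg m = d ->
  ((\sum_(j < n) t j *: 'X_j) ^+ d : {mpoly F[n]})@_m =
    multinomial F m * \prod_(i < n) t i ^+ m i.
Proof.
rewrite /multinomial.
elim: d m => [|d IHd] m.
  move/eqP; rewrite mdeg_eq0 => /eqP ->; rewrite expr0 mcoeff1 eqxx mdeg0.
  by rewrite !big1 ?divr1 ?mulr1 // => i _; rewrite mnm0E.
move=> deg_m; rewrite exprSr mulr_sumr raddf_sum /= deg_m.
have fact_neq0 k : (k`!%:R : F) != 0 by rewrite pnatr_eq0 -lt0n fact_gt0.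
have fact_prod_neq0 (m' : 'X_{1..n}) : ((\prod_(i < n) (m' i)`!)%:R : F) != 0.
  by rewrite natr_prod; apply/prodf_neq0 => i _.
rewrite factS -{1}deg_m mdegE natrM natr_sum !mulr_suml.
apply: eq_bigr => j _; rewrite -scalerAr mcoeffZ mcoeffMXU.
case: posnP => [->|mj_gt0]; first by rewrite mulr0 !mul0r.
have Um : (U_(j) <= m)%MM by rewrite lep1mP -lt0n.
have degm' : mdeg (m - U_(j)) = d.
  apply/eqP; rewrite -(eqn_add2r 1) -[in X in (_ + X)%N](mdeg1 j) -mdegD submK //.
  by rewrite deg_m addn1.
(* Removing one U_j affects only the j-th factor of m! and of t^m. *)
have off_j i : i != j -> (m - U_(j))%MM i = m i.
  by move=> i_neq; rewrite mnmBE mnm1E eq_sym (negPf i_neq) subn0.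
have at_j : m j = ((m - U_(j))%MM j).+1.
  by rewrite mnmBE mnm1E eqxx subn1 prednK.
have factE : (\prod_(i < n) (m i)`! = m j * \prod_(i < n) ((m - U_(j))%MM i)`!)%N.
  rewrite (bigD1 j) //= [in RHS](bigD1 j) //= at_j factS -mulnA -at_j.
  by do 2!congr (_ * _)%N; apply: eq_bigr => i /off_j ->.
have powE : \prod_(i < n) t i ^+ m i = t j * \prod_(i < n) t i ^+ (m - U_(j))%MM i.
  rewrite (bigD1 j) //= [in RHS](bigD1 j) //= {1}at_j exprS -mulrA.
  by do 2!congr (_ * _); apply: eq_bigr => i /off_j ->.
rewrite IHd // degm' powE factE natrM; have := fact_prod_neq0 (m - U_(j))%MM.
have : ((m j)%:R : F) != 0 by rewrite pnatr_eq0 -lt0n.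
by move=> ? ?; field; apply/andP.
Qed.

(** * Homogeneity *)

Lemma prod_homog (R : comNzRingType) (n : nat) (I : finType)
    (F : I -> {mpoly R[n]}) (e : I -> nat) :
  (forall i, F i \is (e i).-homog) -> \prod_i F i \is (\sum_i e i)%N.-homog.
Proof.
move=> F_homog; elim/big_rec2: _ => [|i x y _ y_homog]; first exact: dhomog1.
exact: dhomogM.
Qed.

Lemma homog_msupp (R : nzRingType) (n d : nat) (p : {mpoly R[n]}) (m : 'X_{1..n}) :
  p \is d.-homog -> m \in msupp p -> d = (\sum_(i < n) m i)%N.
Proof. by move=> p_homog mp; rewrite -mdegE; apply/esym/(dhomog_mf p_homog mp). Qed.

Lemma comp_mpoly_homog (R : comNzRingType) (N N' e : nat)
    (T : N.-tuple {mpoly R[N']}) (p : {mpoly R[N]}) :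
  (forall i, tnth T i \is 1.-homog) -> p \is e.-homog -> p \mPo T \is e.-homog.
Proof.
move=> T_lin p_homog; rewrite comp_mpolyE big_seq; apply: rpred_sum => m mp.
rewrite (homog_msupp p_homog mp); apply: rpredZ; apply: prod_homog => i.
by rewrite -[X in X.-homog]mul1n; apply: dhomogMn.
Qed.

(** Homogeneity in the inner variables: the equations of the Fano scheme are
    coefficients, with respect to the outer variables s, of a product that is
    graded by its degree in the matrix entries u. *)
Section CoefHomog.
Variables (R : comNzRingType) (N m : nat).
Implicit Types p q : {mpoly {mpoly R[N]}[m]}.

Definition coef_homog (e : nat) q : Prop :=
  forall alpha, q@_alpha \is e.-homog.

Lemma coef_homog1 : coef_homog 0 1.
Proof. by move=> alpha; rewrite mcoeff1; case: eqP => _; rewrite ?dhomog1 ?dhomog0. Qed.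

Lemma coef_homogM d e p q :
  coef_homog d p -> coef_homog e q -> coef_homog (d + e) (p * q).
Proof.
move=> p_homog q_homog alpha; rewrite mcoeffM; apply: rpred_sum => i _.
exact: dhomogM.
Qed.

Lemma coef_homogX d p e : coef_homog d p -> coef_homog (d * e) (p ^+ e).
Proof.
move=> p_homog; elim: e => [|e IHe]; first by rewrite muln0; apply: coef_homog1.
by rewrite exprS mulnS; apply: coef_homogM.
Qed.

Lemma coef_homog_prod (I : finType) (F : I -> {mpoly {mpoly R[N]}[m]}) (e : I -> nat) :
  (forall i, coef_homog (e i) (F i)) -> coef_homog (\sum_i e i)%N (\prod_i F i).
Proof.
move=> F_homog; elim/big_rec2: _ => [|i x y _ y_homog]; first exact: coef_homog1.
exact: coef_homogM.
Qed.

End CoefHomog.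

(** * Equations of the Fano scheme and their restriction to rank-one matrices *)

Lemma comp_map_mpolyE (A B : comNzRingType) (phi : {rmorphism A -> B}) (n k : nat)
    (T : 'I_n -> {mpoly B[k]}) (p : {mpoly A[n]}) :
  map_mpoly phi p \mPo [tuple T i | i < n] =
    \sum_(m <- msupp p) phi p@_m *: \prod_(i < n) T i ^+ m i.
Proof.
rewrite {1}(mpolyE p) (raddf_sum (map_mpoly _)) raddf_sum /=.
apply: eq_bigr => m _.
rewrite map_mpolyZ map_mpolyX comp_mpolyZ comp_mpolyX.
by congr (_ *: _); apply: eq_bigr => i _; rewrite tnth_mktuple.
Qed.

Section FanoEquations.
Variables (R : realType) (n k : nat).

Lemma plane_coord_homog (i : 'I_n.+1) : coef_homog 1 (plane_coord R k i).
Proof.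
move=> alpha; rewrite raddf_sum; apply: rpred_sum => j _ /=.
rewrite mcoeffCM mcoeffX.
by case: eqP => _; rewrite ?mulr1 ?mulr0 ?rpred0 // dhomogX /= mdeg1.
Qed.

Lemma restrict_to_planeE (f : {mpoly R[i][n.+1]}) :
  restrict_to_plane k f =
    \sum_(m <- msupp f) (f@_m)%:MP *: \prod_(i < n.+1) plane_coord R k i ^+ m i.
Proof. exact: comp_map_mpolyE. Qed.

Lemma fano_coef_homog (d : nat) (f : {mpoly R[i][n.+1]}) (alpha : 'X_{1..k.+1}) :
  f \is d.-homog -> fano_coef f alpha \is d.-homog.
Proof.
move=> f_homog; rewrite /fano_coef restrict_to_planeE raddf_sum big_seq /=.
apply: rpred_sum => m mf; rewrite mcoeffZ mul_mpolyC; apply: rpredZ.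
rewrite (homog_msupp f_homog mf); apply: coef_homog_prod => i.
by rewrite -[X in coef_homog X]mul1n; apply/coef_homogX/plane_coord_homog.
Qed.

(** The substitution u_(j,i) = t_j x_i: all rows are multiples of the same point x,
    so the plane that they span degenerates to that point. *)
Definition rank_one (t : 'I_k.+1 -> R[i]) :
    (k.+1 * n.+1).-tuple {mpoly R[i][n.+1]} :=
  [tuple mxvec (\matrix_(j < k.+1, i < n.+1) (t j *: 'X_i : {mpoly R[i][n.+1]})) 0 r
   | r < (k.+1 * n.+1)%N].

Lemma rank_one_homog t r : tnth (rank_one t) r \is 1.-homog.
Proof.
rewrite tnth_mktuple; case/mxvec_indexP: r => j i.
by rewrite mxvecE mxE rpredZ // dhomogX /= mdeg1.
Qed.

Lemma u_var_rank_one t j i : u_var R j i \mPo rank_one t = t j *: 'X_i.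
Proof. by rewrite comp_mpolyXU -tnth_nth tnth_mktuple mxvecE mxE. Qed.

(** With u_(j,i) = t_j x_i the form f restricts to L^d f(x), where L is the
    linear form sum_j t_j s_j; the coefficient of s^alpha is that of L^d. *)
Lemma fano_coef_rank_one (d : nat) (f : {mpoly R[i][n.+1]}) t (alpha : 'X_{1..k.+1}) :
  f \is d.-homog -> mdeg alpha = d ->
  fano_coef f alpha \mPo rank_one t =
    (multinomial _ alpha * \prod_(j < k.+1) t j ^+ alpha j) *: f.
Proof.
move=> f_homog deg_alpha; rewrite -(mcoeff_linear_expn _ deg_alpha).
set L := (\sum_(j < _) _); pose phi := comp_mpoly (rank_one t).
have -> : fano_coef f alpha \mPo rank_one t =
    (map_mpoly phi (restrict_to_plane k f))@_alpha.
  by rewrite mcoeff_map_mpoly.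
suff -> : map_mpoly phi (restrict_to_plane k f) =
    f *: map_mpoly (@mpolyC n.+1 R[i]) (L ^+ d).
  by rewrite mcoeffZ mcoeff_map_mpoly mulrC mul_mpolyC.
have coordE i : map_mpoly phi (plane_coord R k i) =
    'X_i *: map_mpoly (@mpolyC n.+1 R[i]) L.
  rewrite /L /plane_coord !(raddf_sum (map_mpoly _)) scaler_sumr.
  apply: eq_bigr => j _ /=.
  rewrite rmorphM /= map_mpolyC !map_mpolyX map_mpolyZ map_mpolyX mul_mpolyC scalerA.
  by congr (_ *: _); rewrite [LHS]u_var_rank_one mulrC [RHS]mul_mpolyC.
rewrite restrict_to_planeE (raddf_sum (map_mpoly _)) /= [in RHS](mpolyE f).
rewrite scaler_suml !big_seq.
apply: eq_bigr => m mf; rewrite map_mpolyZ /= comp_mpolyC.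
rewrite -[_ *: 'X_[m]]mul_mpolyC -scalerA; congr (_ *: _).
rewrite -/phi rmorph_prod /= (homog_msupp f_homog mf) rmorphXn /=.
under eq_bigr => i _ do rewrite rmorphXn /= coordE exprZn.
by rewrite scaler_prod -mpolyXE_id prodrXr.
Qed.

(** The degree of an equation determines that of the form it comes from: for t = 1
    the equation specializes to a nonzero multiple of f.  The case f = 0, whose
    equations are homogeneous of every degree, is included. *)
Lemma homog_of_fano_coef (d e : nat) (f : {mpoly R[i][n.+1]}) (alpha : 'X_{1..k.+1}) :
  f \is d.-homog -> mdeg alpha = d -> fano_coef f alpha \is e.-homog ->
  f \is e.-homog.
Proof.
move=> f_homog deg_alpha /(comp_mpoly_homog (rank_one_homog (fun=> 1))).
rewrite (fano_coef_rank_one _ f_homog) // big1 => [|j _]; last by rewrite expr1n.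
by rewrite mulr1 rpredZeq (negPf (multinomial_neq0 _ _)).
Qed.

End FanoEquations.

(** * Strength under linear substitutions *)

(** A linear substitution maps forms to forms of the same degree, hence
    decompositions to decompositions, unless p becomes zero, of strength -oo. *)
Lemma strength_comp_mpoly (R : realType) (N N' e : nat) (T : N.-tuple {mpoly R[i][N']})
    (p : {mpoly R[i][N]}) :
  (forall i, tnth T i \is 1.-homog) -> p \is e.-homog ->
  (strength (p \mPo T) <= strength p)%E.
Proof.
move=> T_lin p_homog; rewrite /strength.
case: ifPn => [_|pT_neq0]; first exact: leNye.
have p_neq0 : p != 0 by apply: contraNneq pT_neq0 => ->; rewrite comp_mpoly0.
rewrite (negPf p_neq0); apply: ereal_inf_le_tmp => _ [s s_dec <-]; exists s => //.
have [g [h [a [b [g_homog h_homog p_sum]]]]] := s_dec.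
have deg_eq : (msize (p \mPo T)).-1 = (msize p).-1.
  have homog_deg n (q : {mpoly R[i][n]}) : q != 0 -> q \is e.-homog -> (msize q).-1 = e.
    by move=> q_neq0 q_homog; apply: dhomog_uniq q_neq0 (dhomog_msize q_homog) q_homog.
  by rewrite !homog_deg // comp_mpoly_homog.
exists (fun i => g i \mPo T), (fun i => h i \mPo T), a, b; split=> [i|i|].
- by have [gi ?] := g_homog i; rewrite deg_eq comp_mpoly_homog.
- by have [hi ?] := h_homog i; rewrite deg_eq comp_mpoly_homog.
- by rewrite p_sum raddf_sum; apply: eq_bigr => i _; rewrite /= rmorphM.
Qed.

(** * The theorem *)

Unset Implicit Arguments.

Theorem theorem1p3 (R : realType) (n c : nat) (d : 'I_c -> nat)
    (f : 'I_c -> {mpoly R[i][n.+1]})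
    (d_gt0 : forall l, (0 < d l)%N)
    (f_homog : forall l, f l \is (d l).-homog)
    (k : nat) (k_ge1 : (1 <= k)%N) :
  exists (m : nat) (g : 'I_m -> {mpoly R[i][(k.+1 * n.+1)%N]}),
    [/\ forall j, homogeneous (g j),
        ideal_generated (range g) = fano_ideal k d f
      & (collective_strength f <= collective_strength g)%E].
Proof.
(* All monomials of degree some d l lie in the finite type 'X_{1..k.+1 < D}. *)
pose D := (\max_(l < c) d l).+1.
pose E := finset (fun x : 'I_c * 'X_{1..k.+1 < D} => mdeg x.2 == d x.1).
pose eqs (x : 'I_c * 'X_{1..k.+1 < D}) := fano_coef (f x.1) x.2.
have eqs_homog x : eqs x \is (d x.1).-homog by exact: fano_coef_homog (f_homog _).
exists #|E|, (fun j => eqs (enum_val j)); split.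
- by move=> j; exists (d (enum_val j).1); exact: eqs_homog.
- congr ideal_generated; apply/seteqP; split=> [_ [j _ <-]|_ [l [alpha [deg_alpha ->]]]].
    exists (enum_val j).1, (enum_val j).2; split=> //.
    by have := enum_valP j; rewrite inE => /eqP.
  have alphaD : (mdeg alpha < D)%N by rewrite deg_alpha ltnS leq_bigmax.
  have xE : (l, BMultinom alphaD) \in E by rewrite inE /= deg_alpha.
  exists (enum_rank_in xE (l, BMultinom alphaD)); first exact: I.
  by rewrite (enum_rankK_in xE xE).
apply: le_ereal_inf_tmp => _ [p [e [a [[j0 aj0_neq0] eqs_e ->]]] <-].
pose lj (j : 'I_#|E|) := (enum_val j).1.
pose mj (j : 'I_#|E|) : 'X_{1..k.+1} := (enum_val j).2.
have deg_mj j : mdeg (mj j) = d (lj j) by have := enum_valP j; rewrite inE => /eqP.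
(* P l is the coefficient that f l acquires, as a polynomial in t. *)
pose P l := \sum_(j | lj j == l) (a j * multinomial R[i] (mj j)) *: 'X_[mj j].
(* The pair (l, alpha) determines the generator, so a j0 cannot be cancelled. *)
have P_neq0 : P (lj j0) != 0.
  apply/eqP => /(congr1 (mcoeff (mj j0))) /eqP; apply/negP.
  rewrite mcoeff0 raddf_sum (bigD1 j0) //= mcoeffZ mcoeffX eqxx mulr1 big1.
    by rewrite addr0 mulf_neq0 // multinomial_neq0.
  move=> j /andP[/eqP eq_l j_neq]; rewrite mcoeffZ mcoeffX.
  case: eqP => [eq_m|]; last by rewrite mulr0.
  case/eqP: j_neq; apply: enum_val_inj; move: eq_l eq_m; rewrite /lj /mj.
  by case: (enum_val j) (enum_val j0) => [l1 m1] [l2 m2] /= -> /val_inj ->.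
have [t Pt_neq0] := mpoly_nonvanishing P_neq0.
have comb : (\sum_j a j *: eqs (enum_val j)) \mPo rank_one n t =
    \sum_l (P l).@[t] *: f l.
  rewrite raddf_sum (partition_big lj xpredT) //=; apply: eq_bigr => l _.
  rewrite /P (raddf_sum (meval t)) scaler_suml; apply: eq_bigr => j /eqP <-.
  rewrite comp_mpolyZ [eqs _ \mPo _](fano_coef_rank_one _ (f_homog _) (deg_mj j)).
  by rewrite scalerA mulrA /= mevalZ mevalX.
apply: (@le_trans _ _ (strength ((\sum_j a j *: eqs (enum_val j)) \mPo rank_one n t))).
  apply: ereal_inf_lbound.
  exists (\sum_l (P l).@[t] *: f l); last by rewrite comb.
  exists e, (fun l => (P l).@[t]); split=> // [|l]; first by exists (lj j0).
  (* If f l is not of degree e, nor is any of its equations, so that a vanishes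
     on all of them. *)
  apply: contraNT => fl_e; rewrite /P big1 ?meval0 // => j /eqP jl.
  suff -> : a j = 0 by rewrite mul0r scale0r.
  apply: contraNeq fl_e => /eqs_e; rewrite -jl.
  exact: homog_of_fano_coef (f_homog _) (deg_mj j).
apply: strength_comp_mpoly; first exact: rank_one_homog.
apply: rpred_sum => j _; have [->|/eqs_e] := eqVneq (a j) 0; last exact: rpredZ.
by rewrite scale0r rpred0.
Qed.
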